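(* Let $R_1$ and $R_2$ be commutative rings with unity with $k_1=\chi(R_1)<\infty$ and $k_2=\chi(R_2)<\infty$. Let $U_1,\ldots,U_{k_1}$ be the color classes of a proper coloring of $R_1$ with $k_1$ colors, and let $V_1,\ldots,V_{k_2}$ be the color classes of a proper coloring of $R_2$ with $k_2$ colors. Let $s_1$ be the number of indices $i\in\{1,\ldots,k_1\}$ such that $U_i$ contains an element $x$ with $x^2=0$, and let $s_2$ be the number of indices $j\in\{1,\ldots,k_2\}$ such that $V_j$ contains an element $y$ with $y^2=0$. Then $$\chi(R_1)+\chi(R_2)-1\le \chi(R_1\times R_2)\le (\chi(R_1)-s_1)+(\chi(R_2)-s_2)+s_1s_2.$$
   Context: All rings are commutative with unity (not necessarily finite). A ring $R$ is regarded as a simple graph whose vertices are all elements of $R$ (including $0$), two distinct vertices $x,y$ being adjacent if and only if $xy=0$. A proper coloring of $R$ is a partition of $R$ into color classes, each of which is an independent set ($xy\ne 0$ for distinct $x,y$ in the class). The chromatic number $\chi(R)$ is the minimum number of color classes in a proper coloring of $R$. *)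

(* Defs.v *)
From HB Require Import structures.
From mathcomp Require Import all_boot all_order all_algebra.
From mathcomp Require Import boolp classical_sets.

Set Implicit Arguments.
Unset Strict Implicit.
Unset Printing Implicit Defensive.

Import GRing.Theory.
Local Open Scope classical_set_scope.
Local Open Scope ring_scope.

(* [comPzRingType] includes the zero ring and does not require finiteness. *)

Definition adjacent (R : comPzRingType) (x y : R) : Prop :=
  x <> y /\ x * y = 0.

Definition independent (R : comPzRingType) (A : set R) : Prop :=
  forall x y : R, A x -> A y -> ~ adjacent x y.

(* [partition] also requires every [U i] to be nonempty, so [k] is the exact
   number of color classes. *)
Definition proper_coloring (R : comPzRingType) (k : nat) (U : 'I_k -> set R) :
    Prop :=
  classical_sets.partition [set: 'I_k] U [set: R] /\
  forall i : 'I_k, independent (U i).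

Definition colorable (R : comPzRingType) (k : nat) : Prop :=
  exists U : 'I_k -> set R, proper_coloring U.

Lemma colorable_ex (R : comPzRingType) :
  (exists k, colorable R k) -> exists k, `[< colorable R k >].
Proof. by move=> [k Rk]; exists k; apply/asboolP. Qed.

(* [None] stands for an infinite chromatic number. *)
Definition chromatic_number (R : comPzRingType) : option nat :=
  match pselect (exists k, colorable R k) with
  | left Rcol => Some (ex_minn (colorable_ex Rcol))
  | right _ => None
  end.

Definition num_nil_classes (R : comPzRingType) (k : nat) (U : 'I_k -> set R) :
    nat :=
  #|[pred i : 'I_k | `[< exists x : R, U i x /\ x ^+ 2 = 0 >]]|.

(* Main.v *)
Require Import Defs.
From HB Require Import structures.
From mathcomp Require Import all_boot all_order all_algebra.
From mathcomp Require Import boolp classical_sets.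

Set Implicit Arguments.
Unset Strict Implicit.
Unset Printing Implicit Defensive.

Import GRing.Theory.

(** Both bounds come from colorings given as functions [c] that separate
    adjacent elements, for which the chromatic number is at most the size of
    any finite set that contains the values of [c] ([chromatic_number_le]).

    Upper bound.  If the class [U i] contains no square-zero element, then
    [x * x' <> 0] for all [x] and [x'] in [U i], equal or not, so the elements
    of [R1 * R2] with first component in [U i] form one independent set,
    whatever their second components are; symmetrically for the second factor.
    Only when both classes contain a square-zero element is the pair of classes
    needed as a color ([prod_color]).  This uses [k1 - s1] colors of the first
    kind, [k2 - s2] of the second and [s1 * s2] of the third.

    Lower bound.  Each axis of [R1 * R2], the elements [(x, 0)] and the elements
    [(0, y)], is a copy of a factor, so a proper coloring shows at least [k1]
    colors on the first axis and at least [k2] on the second.  As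
    [(x, 0) * (0, y) = 0], a color found on both axes can only be that of their
    common point [(0, 0)].  Hence there are at least [k1 + k2 - 1] colors. *)

Definition separates_adjacent (R : comPzRingType) (T : Type) (c : R -> T) :
    Prop :=
  forall x y : R, c x = c y -> ~ adjacent x y.

Lemma chromatic_number_some (R : comPzRingType) (k : nat) :
  chromatic_number R = Some k ->
  colorable R k /\ forall m, colorable R m -> (k <= m)%N.
Proof.
rewrite /chromatic_number; case: pselect => // Rcol [<-].
case: ex_minnP => n /asboolP Rn nmin; split=> // m /asboolP; exact: nmin.
Qed.

Lemma colorable_chromatic_number (R : comPzRingType) (m : nat) :
  colorable R m -> exists k, chromatic_number R = Some k.
Proof.
move=> Rm; rewrite /chromatic_number; case: pselect => [Rcol|[]]; last by exists m.
by eexists.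
Qed.

Lemma proper_coloring_fun (R : comPzRingType) (k : nat) (U : 'I_k -> set R) :
  proper_coloring U ->
  exists2 c : R -> 'I_k, (forall x, U (c x) x) & separates_adjacent c.
Proof.
case=> -[Ucover _ _] Uindep.
have /choice[c Uc] : forall x, exists i, U i x.
  move=> x; have : [set: R]%classic x by [].
  by rewrite -Ucover => -[i _ Uix]; exists i.
exists c => // x y cxy; apply: (Uindep (c x)) => //; by rewrite cxy.
Qed.

(** The color classes are the fibers over the values of [c] only, since classes
    must be nonempty: this is why the number of colors may be less than [#|S|]. *)
Lemma separates_adjacent_colorable (R : comPzRingType) (T : finType)
    (S : {set T}) (c : R -> T) :
  separates_adjacent c -> (forall x, c x \in S) ->
  exists2 m, colorable R m & (m <= #|S|)%N.
Proof.
move=> csep cS.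
pose A := [set t : T | `[< exists x, c x = t >]].
have cA x : c x \in A by rewrite inE; apply/asboolP; exists x.
exists #|A|; last first.
  by apply/subset_leq_card/fintype.subsetP => t; rewrite inE => /asboolP[x <-].
exists (fun i : 'I_#|A| => [set x | c x = enum_val i]%classic); split; last first.
  by move=> i x y /= cx cy; apply: csep; rewrite cx.
split.
- rewrite -subTset => x _.
  by exists (enum_rank_in (cA x) (c x)) => //=; rewrite enum_rankK_in.
- by move=> i j _ _ [x [/= cxi cxj]]; apply: enum_val_inj; rewrite -cxi.
- move=> i _; have := enum_valP i.
  by rewrite inE => /asboolP[x cx]; exists x.
Qed.

Lemma chromatic_number_le (R : comPzRingType) (T : finType) (k : nat)
    (S : {set T}) (c : R -> T) :
  chromatic_number R = Some k ->
  separates_adjacent c -> (forall x, c x \in S) -> (k <= #|S|)%N.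
Proof.
move=> /chromatic_number_some[_ kmin] csep cS.
have [m /kmin km mS] := separates_adjacent_colorable csep cS.
exact: leq_trans km mS.
Qed.

(** A coloring of the product restricts to one of each axis, and the two
    restrictions share only the color of the origin, so the inclusion-exclusion
    formula for the two sets of colors loses at most one. *)
Lemma chromatic_number_prod_ge (R1 R2 : comPzRingType) (k1 k2 k : nat) :
  chromatic_number R1 = Some k1 -> chromatic_number R2 = Some k2 ->
  chromatic_number (R1 * R2)%type = Some k -> (k1 + k2 - 1 <= k)%N.
Proof.
move=> chi1 chi2 /chromatic_number_some[[W colW] _].
have [c _ csep] := proper_coloring_fun colW.
pose A := [set t : 'I_k | `[< exists x : R1, c (x, 0%R) = t >]].
pose B := [set t : 'I_k | `[< exists y : R2, c (0%R, y) = t >]].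
have k1A : (k1 <= #|A|)%N.
  apply: (chromatic_number_le (c := fun x => c (x, 0%R)) chi1) => [x x' cxx' [nxx' xx'0]|x].
  - by apply: (csep _ _ cxx'); split=> [[]//|]; congr pair; rewrite //= mulr0.
  - by rewrite inE; apply/asboolP; exists x.
have k2B : (k2 <= #|B|)%N.
  apply: (chromatic_number_le (c := fun y => c (0%R, y)) chi2) => [y y' cyy' [nyy' yy'0]|y].
  - by apply: (csep _ _ cyy'); split=> [[]//|]; congr pair; rewrite //= mulr0.
  - by rewrite inE; apply/asboolP; exists y.
have AB : (#|A :&: B| <= 1)%N.
  rewrite -(cards1 (c (0%R, 0%R))); apply/subset_leq_card/fintype.subsetP => t.
  rewrite !inE => /andP[/asboolP[x <-] /asboolP[y cyx]].
  have [[-> _]//|xy] := pselect ((x, 0%R) = (0%R, y) :> R1 * R2).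
  case: (csep _ _ (esym cyx)); split=> //.
  by congr pair; rewrite /= ?mulr0 ?mul0r.
rewrite leq_subLR (leq_trans (leq_add k1A k2B)) // -cardsUI addnC leq_add //.
by rewrite -[leqRHS]card_ord max_card.
Qed.

Section ProductColoring.

Variables (R1 R2 : comPzRingType) (T1 T2 : finType).
Variables (c1 : R1 -> T1) (c2 : R2 -> T2) (N1 : {set T1}) (N2 : {set T2}).

Definition prod_color (z : R1 * R2) : T1 + (T2 + T1 * T2) :=
  if c1 z.1 \notin N1 then inl (c1 z.1)
  else if c2 z.2 \notin N2 then inr (inl (c2 z.2))
  else inr (inr (c1 z.1, c2 z.2)).

Definition prod_colors : {set T1 + (T2 + T1 * T2)} :=
  (@inl T1 _ @: ~: N1)
  :|: (@inr T1 _ @: ((@inl T2 _ @: ~: N2) :|: (@inr T2 _ @: finset.setX N1 N2))).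

Lemma prod_color_in z : prod_color z \in prod_colors.
Proof.
rewrite /prod_color; have [N1z|N1z] /= := boolP (c1 z.1 \in N1); last first.
  by rewrite finset.in_setU imset_f // inE.
have [N2z|N2z] /= := boolP (c2 z.2 \in N2); rewrite finset.in_setU orbC imset_f //.
  by rewrite finset.in_setU orbC imset_f // finset.in_setX N1z.
by rewrite finset.in_setU imset_f // inE.
Qed.

Lemma card_prod_colors :
  (#|prod_colors| <= (#|T1| - #|N1|) + (#|T2| - #|N2|) + #|N1| * #|N2|)%N.
Proof.
have cardC (T : finType) (N : {set T}) : #|~: N| = (#|T| - #|N|)%N.
  by rewrite -(cardsC N) addKn.
rewrite -addnA -!cardC -cardsX (leq_trans (leq_card_setU _ _)) //.
apply: leq_add; first exact: leq_imset_card.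
apply: leq_trans (leq_imset_card _ _) _.
by apply: leq_trans (leq_card_setU _ _) _; apply: leq_add; apply: leq_imset_card.
Qed.

Hypotheses (sep1 : separates_adjacent c1) (sep2 : separates_adjacent c2).
Hypothesis nil1 : forall x, (x ^+ 2 = 0)%R -> c1 x \in N1.
Hypothesis nil2 : forall y, (y ^+ 2 = 0)%R -> c2 y \in N2.

(** Two distinct elements of a class never multiply to zero; outside [N1] and
    [N2] this holds for equal elements as well, so that one component already
    forces a nonzero product.  With both components in square-zero classes,
    distinctness of the pairs gives a component where the elements differ. *)
Lemma prod_color_separates : separates_adjacent prod_color.
Proof.
have nonadj (R : comPzRingType) (T : finType) (c : R -> T) (N : {set T}) :
    separates_adjacent c -> (forall x, (x ^+ 2 = 0)%R -> c x \in N) ->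
    forall x x', c x = c x' -> (x * x' = 0)%R -> c x \notin N -> False.
  move=> csep cN x x' cxx' xx'0 /negP; apply.
  have [eqx|neqx] := pselect (x = x'); last by case: (csep _ _ cxx').
  by apply: cN; rewrite expr2 {2}eqx.
move=> [x y] [x' y'] /= czz' [neq zz'0].
have xx'0 : (x * x' = 0)%R by case: zz'0.
have yy'0 : (y * y' = 0)%R by case: zz'0.
move: czz'; rewrite /prod_color /=.
have [N1x|N1x] /= := boolP (c1 x \in N1); last first.
  case: ifP => _ //=; last by case: ifP.
  by case=> cxx'; apply: (nonadj _ _ _ _ sep1 nil1 x x').
have [N2y|N2y] /= := boolP (c2 y \in N2); case: ifP => _ //=; last first.
  by case: ifP => _ //= -[cyy']; apply: (nonadj _ _ _ _ sep2 nil2 y y').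
case: ifP => _ //= -[cxx' cyy'].
have [eqx|neqx] := pselect (x = x'); last by case: (sep1 cxx').
by apply: (sep2 cyy'); split=> // eqy; apply: neq; rewrite eqx eqy.
Qed.

End ProductColoring.

(* The truncated subtractions below are exact: a ring is nonempty, so its
   chromatic number is positive, and [s1 <= k1], [s2 <= k2]. *)
Theorem theorem3p1 (R1 R2 : comPzRingType) (k1 k2 : nat)
    (chi1 : chromatic_number R1 = Some k1)
    (chi2 : chromatic_number R2 = Some k2)
    (U : 'I_k1 -> set R1) (V : 'I_k2 -> set R2)
    (colU : proper_coloring U) (colV : proper_coloring V)
    (s1 s2 : nat)
    (def_s1 : s1 = num_nil_classes U) (def_s2 : s2 = num_nil_classes V) :
  exists k : nat, chromatic_number (R1 * R2)%type = Some k /\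
    (k1 + k2 - 1 <= k)%N /\ (k <= (k1 - s1) + (k2 - s2) + s1 * s2)%N.
Proof.
have [c1 Uc1 sep1] := proper_coloring_fun colU.
have [c2 Vc2 sep2] := proper_coloring_fun colV.
pose N1 := [set i : 'I_k1 | `[< exists x, U i x /\ (x ^+ 2 = 0)%R >]].
pose N2 := [set j : 'I_k2 | `[< exists y, V j y /\ (y ^+ 2 = 0)%R >]].
have cardN1 : #|N1| = s1 by rewrite def_s1 cardsE.
have cardN2 : #|N2| = s2 by rewrite def_s2 cardsE.
have nil1 x : (x ^+ 2 = 0)%R -> c1 x \in N1.
  by move=> x0; rewrite inE; apply/asboolP; exists x.
have nil2 y : (y ^+ 2 = 0)%R -> c2 y \in N2.
  by move=> y0; rewrite inE; apply/asboolP; exists y.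
have sep := prod_color_separates sep1 sep2 nil1 nil2.
have inS := prod_color_in c1 c2 N1 N2.
have [m /colorable_chromatic_number[k chi] _] := separates_adjacent_colorable sep inS.
exists k; split=> //; split; first exact: chromatic_number_prod_ge chi1 chi2 chi.
apply: leq_trans (chromatic_number_le chi sep inS) _.
by rewrite (leq_trans (card_prod_colors _ _)) // !card_ord cardN1 cardN2.
Qed.
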